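(* For all sufficiently large $x$, there is a set $\mathcal{E}(x)\subseteq\{1,\dots,\lfloor x\rfloor\}$ with $\#\mathcal{E}(x)=o(x)$ as $x\to\infty$, such that the following holds: uniformly for all positive integers $d>x^{1/(2\log_3 x)}$ satisfying $P^{-}(d)>\log_2 x$, the number of $n\le x$ with $n\notin\mathcal{E}(x)$ and $d\mid s(n)$ is \[ \ll \frac{x}{d^{1/4}\log x}, \] with an absolute implied constant.
   Context: $s(n):=\sum_{d\mid n,\ d<n} d$ is the sum of proper divisors of $n$. $P^{-}(d)$ denotes the smallest prime factor of $d$ (with $P^{-}(1)=\infty$). $\log_k$ denotes the $k$-fold iterated natural logarithm, so $\log_2 x=\log\log x$ and $\log_3 x=\log\log\log x$. *)

(* Defs.v *)
(* Library: MathComp-Analysis, over an arbitrary [R : realType]. *)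
From mathcomp Require Export all_boot all_order all_algebra finmap.
From mathcomp Require Export all_classical all_reals all_analysis.
Export Order.TTheory GRing.Theory Num.Theory.
Export numFieldNormedType.Exports.
Set Implicit Arguments.
Unset Strict Implicit.
Unset Printing Implicit Defensive.
Local Open Scope ring_scope.

Definition aliquot (n : nat) : nat := (\sum_(d <- divisors n | d < n) d)%N.

(* [pdiv] takes the value 1 at 1, hence the separate case. *)
Definition Pminus (R : realType) (d : nat) : \bar R :=
  if d == 1%N then +oo%E else ((pdiv d)%:R : R)%:E.

Definition logk (R : realType) (k : nat) (x : R) : R := iter k (@ln R) x.

Definition upto (R : realType) (x : R) : {fset nat} :=
  [fset n in iota 1 (Num.truncn x)]%fset.

Lemma in_upto (R : realType) (x : R) (n : nat) :
  (n \in upto x) = (0 < n)%N && (n%:R <= x).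
Proof.
rewrite !inE /= mem_iota add1n ltnS.
by case: n => [//|n] /=; rewrite truncn_gt_nat.
Qed.

(* Main.v *)
Require Import Defs.
From mathcomp Require Import zify ring lra.

(* Outside a set of density zero, [n] has no square divisor above [(ln x) ^ 2],
   [n > x / ln x], and [gcd(n, sigma n) <= H := x ^ (1 / (80 log_3 x))]; the gcd
   is controlled by Markov's inequality for its logarithm, because a large prime
   [p] dividing it forces [p (k p - 1) | n] for some [k].  Put [y = d ^ (1/40)],
   so [H <= y].  If [d | s(n)] for such an [n], stripping prime powers from [n]
   gives a unitary divisor [b] of [n] which is either a prime above [y ^ 12] or
   lies in [(y ^ 12, y ^ 24]].  Fix the cofactor [a = n / b] and a dyadic range
   for [b].  Two admissible [b, b'] satisfy
   [sigma b * b' = sigma b' * b] modulo [d / gcd(d, sigma a) >= d / H].  For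
   primes this is a single residue class; in general the ratios [sigma b / b]
   are either equal or well spaced, and [b] is determined by its ratio together
   with [gcd(b, sigma b) <= H].  Summing over [a <= x / b] gives
   [O(x (ln x) ^ 2 / y ^ 11)], and [(ln x) ^ 3 <= y]. *)

Set Implicit Arguments.
Unset Strict Implicit.
Unset Printing Implicit Defensive.
Local Open Scope nat_scope.

(** * The sum-of-divisors function *)

Definition sigma (n : nat) : nat := \sum_(d <- divisors n) d.

Lemma aliquotD (n : nat) : 0 < n -> aliquot n + n = sigma n.
Proof.
move=> n0; rewrite /sigma (bigD1_seq n) ?divisors_uniq -?dvdn_divisors //=.
rewrite addnC; congr (_ + _)%N.
rewrite /aliquot big_seq_cond [RHS]big_seq_cond; apply: eq_bigl => d.
case: (boolP (d \in _)) => //=; rewrite -dvdn_divisors // => /dvdn_leq dn.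
by rewrite ltn_neqAle dn // andbT.
Qed.

(** A divisor [d] of [a * b] factors as [gcdn d a * gcdn d b], and conversely [gcdn (i * j) a = i];
    this bijection makes [sigma] multiplicative. *)
Lemma perm_divisorsM (a b : nat) : coprime a b -> 0 < a -> 0 < b ->
  perm_eq (divisors (a * b)) [seq i * j | i <- divisors a, j <- divisors b].
Proof.
move=> cab a0 b0; have ab0 : 0 < a * b by rewrite muln_gt0 a0.
apply: uniq_perm; first exact: divisors_uniq.
  apply: allpairs_uniq; rewrite ?divisors_uniq // => -[i j] [i' j'] /=.
  move=> /allpairsP[[i1 j1] /= [+ + [-> ->]]].
  move=> + + /allpairsP[[i2 j2] /= [+ + [-> ->]]].
  rewrite -!dvdn_divisors // => i1a j1b i2a j2b e.
  have gi k l : k %| a -> l %| b -> gcdn (k * l) a = k.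
    move=> ka lb; rewrite gcdnC Gauss_gcdl; first by rewrite gcdnC; apply/gcdn_idPl.
    by apply: coprime_dvdr lb _.
  have i12 : i1 = i2 by rewrite -(gi i1 j1) // e gi.
  have i0 : 0 < i1 by apply: dvdn_gt0 i1a.
  by move/eqP: e; rewrite -i12 eqn_pmul2l // => /eqP ->.
move=> d; rewrite -dvdn_divisors //; apply/idP/allpairsP => /=.
  move=> dab; exists (gcdn d a, gcdn d b); rewrite -!dvdn_divisors // !dvdn_gcdr.
  split=> //=; apply/eqP; rewrite eqn_dvd; apply/andP; split; last first.
    rewrite Gauss_dvd ?dvdn_gcdl // /coprime -dvdn1.
    move: cab; rewrite /coprime => /eqP <-.
    by rewrite dvdn_gcd (dvdn_trans (dvdn_gcdl _ _) (dvdn_gcdr _ _))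
       (dvdn_trans (dvdn_gcdr _ _) (dvdn_gcdr _ _)).
  rewrite muln_gcdl dvdn_gcd dvdn_mulr //= muln_gcdr dvdn_gcd dvdn_mull //=.
move=> [[i j] /= [+ + ->]]; rewrite -!dvdn_divisors // => ? ?.
exact: dvdn_mul.
Qed.

Lemma sigmaM (a b : nat) : coprime a b -> 0 < a -> 0 < b ->
  sigma (a * b) = sigma a * sigma b.
Proof.
move=> cab a0 b0; rewrite /sigma (perm_big _ (perm_divisorsM cab a0 b0)) /=.
rewrite big_allpairs_dep /= big_distrl /=; apply: eq_bigr => i _.
by rewrite big_distrr.
Qed.

Lemma sigma_prime (p : nat) : prime p -> sigma p = p.+1.
Proof.
move=> pp; have p1 := prime_gt1 pp; have p0 := prime_gt0 pp.
rewrite /sigma (perm_big [:: 1; p]) /=; first by rewrite big_cons big_seq1.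
apply: uniq_perm; rewrite ?divisors_uniq //= ?inE ?(ltn_eqF p1) // => d.
rewrite -dvdn_divisors // !inE; apply/idP/orP => [|[/eqP->//|/eqP->//]].
by move=> dp; case/primeP: pp => _ /(_ d dp) /orP.
Qed.

Lemma sigma_gt0 (n : nat) : 0 < n -> 0 < sigma n.
Proof. by move=> n0; rewrite -aliquotD // addn_gt0 n0 orbT. Qed.

(** There are at most [n] divisors, each at most [n]. This crude square is why the cut-off for large
    primes below is [K ^ 6 = (K ^ 3) ^ 2]. *)
Lemma sigma_le_sqr (n : nat) : 0 < n -> sigma n <= n ^ 2.
Proof.
move=> n0; apply: (@leq_trans (\sum_(d <- divisors n) n)).
  rewrite /sigma big_seq [leqRHS]big_seq; apply: leq_sum => d.
  by rewrite -dvdn_divisors // => /dvdn_leq; apply.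
rewrite big_const_seq count_predT iter_addn_0 expnS expn1 leq_mul2l.
apply/orP; right; rewrite -[leqRHS](size_iota 1).
apply: uniq_leq_size; first exact: divisors_uniq.
move=> d; rewrite -dvdn_divisors // mem_iota => dn.
by have := dvdn_leq n0 dn; have := dvdn_gt0 n0 dn; lia.
Qed.

Lemma coprime_partn (p n : nat) : coprime n`_p n`_p^'.
Proof. by apply: coprime_partC. Qed.

(** By multiplicativity [p] divides the [sigma] of some prime-power component; the induction removes
    one component at a time. *)
Lemma prime_dvd_sigma (p n : nat) : prime p -> 0 < n -> p %| sigma n ->
  exists2 q, q \in primes n & p %| sigma n`_q.
Proof.
move=> pp; have [m] := ubnP n; elim: m n => // m IH n nm n0 pn.
have [n1|n1] := leqP n 1.
  have e : n = 1 by lia.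
  move: pn; rewrite e /sigma (_ : divisors 1 = [:: 1]) // big_seq1.
  by rewrite dvdn1 => /eqP e1; rewrite e1 in pp.
pose q := pdiv n; have qp : prime q by apply: pdiv_prime.
have qn : q \in primes n by rewrite mem_primes qp n0 pdiv_dvd.
move: pn; rewrite -[in sigma n](partnC q n0) sigmaM ?part_gt0 ?coprime_partn //.
rewrite Euclid_dvdM // => /orP[?|pq]; first by exists q.
have lt : n`_q^' < n.
  rewrite -[ltnRHS](partnC q n0) ltn_Pmull ?part_gt0 //.
  by rewrite p_part -(expn0 q) ltn_exp2l ?prime_gt1 // logn_gt0.
have [|r rn pr] := IH _ (leq_trans lt _) (part_gt0 _ _) pq; first by lia.
have rq : r \in q^'.
  by move: rn; rewrite primes_part mem_filter => /andP[].
exists r; first by move: rn; rewrite primes_part mem_filter => /andP[].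
move: pr; rewrite partn_part // => t; rewrite !inE => /eqP ->.
by move: rq; rewrite !inE.
Qed.

(** * Large primes dividing [gcdn n (sigma n)] *)

Definition sqfree_above (K n : nat) := forall k, K < k -> ~~ (k ^ 2 %| n).

(** With [a = logn q n], the square of [q ^ a./2] divides [n], so [q ^ a./2 <= K]; and
    [a <= 3 * a./2] as soon as [a >= 2]. *)
Lemma partn_sqfree_above (K n q : nat) : sqfree_above K n -> 0 < n -> prime q ->
  1 < logn q n -> n`_q <= K ^ 3.
Proof.
move=> sf n0 pq l; rewrite p_part; set a := logn q n in l *.
have le : q ^ (a./2) <= K.
  rewrite leqNgt; apply/negP => /sf /negP; apply.
  rewrite -expnM pfactor_dvdn // -/a; lia.
have q0 := prime_gt0 pq.
apply: (@leq_trans ((q ^ a./2) ^ 3)); last by rewrite leq_exp2r.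
rewrite -expnM leq_pexp2l //; lia.
Qed.

(* A prime above [K ^ 6] that divides [gcdn n (sigma n)] comes from a prime
   factor [q = k * p - 1] of [n]. *)
Lemma logn_gcd_sigma (K N n p : nat) : 0 < n <= N -> sqfree_above K n ->
  prime p -> K ^ 6 < p -> 0 < K ->
  logn p (gcdn n (sigma n)) <= \sum_(1 <= k < N.+1) (p * (k * p).-1 %| n).
Proof.
move=> /andP[n0 nN] sf pp pK K0.
have [->//|] := posnP (logn p (gcdn n (sigma n))).
have g0 : 0 < gcdn n (sigma n) by rewrite gcdn_gt0 n0.
rewrite logn_gt0 mem_primes pp g0 /= dvdn_gcd => /andP[pn ps].
have K1 : K <= K ^ 6 by rewrite -[leqLHS]expn1 leq_pexp2l.
(* The exponent of [p] is at most 1, since [p > K] and so [p ^ 2] does not divide [n]; one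
   contributing [k] is then enough. *)
apply: (@leq_trans 1).
  apply: (leq_trans (dvdn_leq_log _ n0 (dvdn_gcdl n (sigma n)))).
  rewrite leqNgt; apply/negP => l2; move/negP: (sf p (leq_ltn_trans K1 pK)).
  by apply; rewrite pfactor_dvdn.
have [q] := prime_dvd_sigma pp n0 ps; rewrite mem_primes n0 /= => /andP[qp qn] pq.
have l0 : 0 < logn q n by rewrite logn_gt0 mem_primes qp n0.
(* Otherwise the [q]-part of [n] is at most [K ^ 3], and its [sigma], a positive multiple of [p], is
   at most [K ^ 6 < p]. *)
have lq : logn q n = 1.
  apply/eqP; rewrite eqn_leq l0 andbT leqNgt; apply/negP => l2.
  have h := partn_sqfree_above sf n0 qp l2.
  have := dvdn_leq (sigma_gt0 (part_gt0 _ _)) pq.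
  have := sigma_le_sqr (part_gt0 q n).
  have : (n`_q) ^ 2 <= (K ^ 3) ^ 2 by rewrite leq_exp2r.
  rewrite -expnM; lia.
move: pq; rewrite p_part lq expn1 sigma_prime // => /dvdnP[k kE].
have p1 := prime_gt1 pp.
have k0 : 0 < k by case: k kE.
have qE : q = (k * p).-1 by rewrite -kE.
have qN : q <= N by apply: leq_trans nN; apply: dvdn_leq.
have kN : k < N.+1 by nia.
rewrite (big_cat_nat (n := k)) //=; last by lia.
rewrite [X in _ + X]big_ltn // -qE Gauss_dvd ?pn ?qn /=; first by lia.
(* [p] and [q] are distinct because [p] divides [q + 1]. *)
rewrite prime_coprime // dvdn_prime2 //; apply/eqP => e.
by move: kE; rewrite -e => h; have := dvdn_mull k (dvdnn p); rewrite -h -addn1 dvdn_addr // dvdn1; lia.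
Qed.

(** * Unitary divisors and ratios [sigma b / b] *)

Definition unitary (b n : nat) := (b %| n) && coprime b (n %/ b).

Lemma unitary_partn (n : nat) (pi : nat_pred) : 0 < n -> unitary n`_pi n.
Proof.
move=> n0; rewrite /unitary dvdn_part /= -{2}(partnC pi n0) mulKn ?part_gt0 //.
exact: coprime_partC.
Qed.

Lemma unitary_trans (b c n : nat) : 0 < n -> unitary b c -> unitary c n ->
  unitary b n.
Proof.
move=> n0 /andP[bc cbc] /andP[cn cnc].
have c0 : 0 < c by apply: dvdn_gt0 cn.
have b0 : 0 < b by apply: dvdn_gt0 bc.
rewrite /unitary (dvdn_trans bc cn) /=.
have -> : n %/ b = (c %/ b) * (n %/ c).
  have nE : n = n %/ c * (c %/ b) * b by rewrite -mulnA !divnK.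
  by rewrite [LHS](congr1 (divn^~ b) nE) mulnK // mulnC.
by rewrite coprimeMr cbc (coprime_dvdl bc).
Qed.

(** While [c > U ^ 2], dividing out its component at the smallest prime, which is at most [U],
    leaves a unitary divisor still above [U]. *)
Lemma unitary_stripping (U n : nat) : 0 < n -> (forall q, prime q -> n`_q <= U) ->
  forall c, unitary c n -> U < c -> exists2 b, unitary b n & U < b <= U ^ 2.
Proof.
move=> n0 qU c; have [m] := ubnP c; elim: m c => // m IH c cm uc Uc.
have [le|lt] := leqP c (U ^ 2); first by exists c; rewrite ?Uc.
have c0 : 0 < c by lia.
have c1 : 1 < c.
  rewrite ltn_neqAle c0 andbT; apply/eqP => c1.
  have U0 : U = 0 by lia.
  by have := qU 2 isT; rewrite U0 leqn0 => /eqP h; have := part_gt0 2 n; rewrite h.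
pose q := pdiv c; have qp : prime q by apply: pdiv_prime.
have cq : c`_q <= U.
  apply: leq_trans (qU q qp); apply: dvdn_leq; first exact: part_gt0.
  by apply: partn_dvd => //; case/andP: uc.
have cE := partnC q c0.
have q1 : 1 < c`_q.
  by rewrite p_part -(expn0 q) ltn_exp2l ?prime_gt1 // logn_gt0 mem_primes qp c0 pdiv_dvd.
have qc0 := part_gt0 q^' c.
apply: (IH c`_q^'); [nia| |nia].
by apply: unitary_trans uc => //; apply: unitary_partn.
Qed.

(** A prime-power component above [U] is a prime to the first power, since higher powers are at most
    [K ^ 3 <= U]. If there is no such component, stripping starts from [n] itself. *)
Lemma unitary_divisor_between (K U n : nat) : sqfree_above K n -> 0 < K ->
  K ^ 3 <= U -> U < n ->
  exists2 b, unitary b n & (prime b && (U < b)) || (U < b <= U ^ 2).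
Proof.
move=> sf K0 KU Un; have n0 : 0 < n by lia.
have [[q qp Uq]|no] := pselect (exists2 q, prime q & U < n`_q).
  exists n`_q; first exact: unitary_partn.
  have -> : n`_q = q.
    have [l0|l1|l1] := ltngtP (logn q n) 1.
    - have K3 : 0 < K ^ 3 by rewrite expn_gt0 K0.
      by move: Uq; rewrite p_part (_ : logn q n = 0) ?expn0; lia.
    - by have := partn_sqfree_above sf n0 qp l1; lia.
    - by rewrite p_part l1.
  rewrite qp /=; have [qU|//] := leqP q U.
  move: Uq; rewrite p_part.
  have [l1|l1] := leqP (logn q n) 1.
    by case: (logn q n) l1 => [|[|]] // _; rewrite ?expn0 ?expn1 /=; lia.
  by have := partn_sqfree_above sf n0 qp l1; rewrite p_part; lia.
have qU q : prime q -> n`_q <= U.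
  by move=> qp; rewrite leqNgt; apply/negP => Uq; apply: no; exists q.
have un : unitary n n by rewrite /unitary dvdnn divnn n0 coprimen1.
have [b ub hb] := unitary_stripping n0 qU un Un.
by exists b; rewrite // hb orbT.
Qed.

(* If [d] divides both [s(ab)] and [s(ab')], then
   [sigma a * (sigma b * b' - sigma b' * b)] is [0] modulo [d]. *)
Lemma dvdn_cross (a b b' d H : nat) : coprime a b -> coprime a b' ->
  0 < a -> 0 < b -> 0 < b' -> 0 < d ->
  d %| aliquot (a * b) -> d %| aliquot (a * b') ->
  gcdn (a * b) (sigma (a * b)) <= H ->
  exists2 e, d %/ H <= e & sigma b * b' = sigma b' * b %[mod e].
Proof.
move=> cab cab' a0 b0 b'0 d0 dab dab' gH.
have ab0 : 0 < a * b by rewrite muln_gt0 a0.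
have ab'0 : 0 < a * b' by rewrite muln_gt0 a0.
(* [g] divides both [sigma (a * b)] and [aliquot (a * b)], hence their difference [a * b]; so it is
   at most [H]. The modulus will be [d / g]. *)
pose g := gcdn d (sigma a).
have g0 : 0 < g by rewrite gcdn_gt0 d0.
have gd : g %| d by apply: dvdn_gcdl.
have gs : g %| sigma (a * b) by rewrite sigmaM // dvdn_mulr // dvdn_gcdr.
have gab : g %| a * b.
  by move: gs; rewrite -aliquotD // dvdn_addr // (dvdn_trans gd).
have gleH : g <= H.
  by apply: leq_trans gH; apply: dvdn_leq; rewrite ?gcdn_gt0 ?ab0 // dvdn_gcd gab.
exists (d %/ g); first exact: leq_div2l.
(* An order is fixed because the difference used below is a truncated subtraction. *)
wlog le : b b' cab cab' b0 b'0 dab dab' {gH gs gab ab0 ab'0} / sigma b' * b <= sigma b * b'.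
  move=> wl; have [le|lt] := leqP (sigma b' * b) (sigma b * b'); first exact: wl.
  by apply/esym; apply: wl => //; apply: ltnW.
have ab0 : 0 < a * b by rewrite muln_gt0 a0.
have ab'0 : 0 < a * b' by rewrite muln_gt0 a0.
apply/eqP; rewrite eqn_mod_dvd //.
have : d %| sigma a * (sigma b * b' - sigma b' * b).
  rewrite mulnBr !mulnA -!sigmaM // -!aliquotD //.
  have -> : (aliquot (a * b) + a * b) * b' - (aliquot (a * b') + a * b') * b =
            aliquot (a * b) * b' - aliquot (a * b') * b by nia.
  by apply: dvdn_sub; apply: dvdn_mulr.
(* After division by [g], the factor [sigma a / g] is coprime to [d / g] and cancels. *)
rewrite -{1}(divnK gd) -{1}(divnK (dvdn_gcdr d (sigma a))) -/g.
rewrite mulnAC dvdn_pmul2r // Gauss_dvdr //.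
rewrite /coprime -(eqn_pmul2r g0) mul1n muln_gcdl !divnK //; exact: dvdn_gcdr.
Qed.

Lemma eqn_modulo_close (e m n : nat) : m = n %[mod e] -> m < n + e -> n < m + e ->
  m = n.
Proof.
wlog le : m n / m <= n.
  move=> wl h h1 h2; have [le|lt] := leqP m n; first exact: wl.
  by apply/esym; apply: wl => //; apply: ltnW.
move=> h _ h2; move/eqP: h; rewrite eq_sym eqn_mod_dvd // => /dvdnP[k hk].
by case: k hk => [|k] hk; nia.
Qed.

(** Equal floors put the two ratios within [1 / Q] of each other, so the cross products differ by
    less than [b * b' / Q < e] and the congruence is an equality. The ratios then agree in lowest
    terms, and the gcd recovers the denominator. *)
Lemma ratio_inj (b b' Q e : nat) : 0 < b -> 0 < b' ->
  sigma b * b' = sigma b' * b %[mod e] -> b * b' < Q * e ->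
  (Q * sigma b) %/ b = (Q * sigma b') %/ b' ->
  gcdn b (sigma b) = gcdn b' (sigma b') -> b = b'.
Proof.
move=> b0 b'0 hm hQ hc hg.
have r1 := ltn_pmod (Q * sigma b) b0; have r2 := ltn_pmod (Q * sigma b') b'0.
have q1 := divn_eq (Q * sigma b) b; have q2 := divn_eq (Q * sigma b') b'.
move: (Q * sigma b %% b) (Q * sigma b' %% b') r1 r2 q1 q2 => r r' r1 r2.
rewrite hc; set c := _ %/ b' => q1 q2.
have Q0 : 0 < Q by case: Q hQ {hc q1 q2 c}.
have cross : sigma b * b' = sigma b' * b.
  apply: eqn_modulo_close hm _ _.
    rewrite -(ltn_pmul2l Q0) mulnDr !mulnA q1 q2; nia.
  rewrite -(ltn_pmul2l Q0) mulnDr !mulnA q1 q2; nia.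
set g := gcdn b (sigma b) in hg.
have g0 : 0 < g by rewrite gcdn_gt0 b0.
have bE : b * gcdn b' (sigma b') = b' * gcdn b (sigma b).
  rewrite !muln_gcdr; congr gcdn; first exact: mulnC.
  by rewrite mulnC -cross mulnC.
by move/eqP: bE; rewrite -hg eqn_pmul2r // => /eqP.
Qed.

Lemma size_le_triple (s : seq nat) (A B C : nat) (f g h : nat -> nat) : uniq s ->
  {in s, forall n, [/\ f n < A, g n < B & h n < C]} ->
  {in s &, forall m n, f m = f n -> g m = g n -> h m = h n -> m = n} ->
  size s <= A * B * C.
Proof.
move=> us hs inj; pose F n := (f n, g n, h n).
rewrite -(size_map F); set S := [seq (ij, k) | ij <- [seq (i, j) | i <- iota 0 A, j <- iota 0 B], k <- iota 0 C].
have -> : A * B * C = size S by rewrite !size_allpairs !size_iota.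
apply: uniq_leq_size.
  by rewrite map_inj_in_uniq // => m n ms ns [? ? ?]; apply: inj.
move=> _ /mapP[n /hs[fA gB hC] ->]; apply/allpairsP; exists (f n, g n, h n).
by split=> //=; rewrite ?mem_iota //; apply/allpairsP; exists (f n, g n); rewrite !mem_iota.
Qed.

Lemma size_le_sum_count (T : nat) (P : nat -> pred nat) (s : seq nat) :
  {in s, forall n, exists2 k, k < T & P k n} ->
  size s <= \sum_(k < T) count (P k) s.
Proof.
elim: s => [//|n s IH] hs /=; rewrite big_split /= -add1n leq_add //.
  have [k kT Pk] := hs n (mem_head _ _).
  by rewrite (bigD1 (Ordinal kT)) //= Pk.
by apply: IH => m ms; apply: hs; rewrite inE ms orbT.
Qed.

(** * Dyadic counting *)

Section DyadicCount.
Variables (d H N k : nat) (s : seq nat) (beta : nat -> nat).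
Hypotheses (us : uniq s) (H0 : 0 < H) (Hd : H <= d).
Hypothesis sP : {in s, forall n, [/\ 0 < n <= N, d %| aliquot n,
  gcdn n (sigma n) <= H, unitary (beta n) n & 2 ^ k <= beta n < 2 ^ k.+1]}.

Let e0 : 0 < d %/ H. Proof. by rewrite divn_gt0. Qed.

Let cofactor n := n %/ beta n.

Let cofactor_lt n : n \in s -> cofactor n < (N %/ 2 ^ k).+1.
Proof.
move=> /sP[/andP[n0 nN] _ _ _ /andP[kb _]]; rewrite ltnS.
apply: (@leq_trans (n %/ 2 ^ k)); last exact: leq_div2r.
by apply: leq_div2l; rewrite ?expn_gt0.
Qed.

(** Once the cofactor is fixed, counting [n] amounts to counting values of [beta n] that are linked
    pairwise by a congruence to a large modulus. *)
Let same_cofactor m n : m \in s -> n \in s -> cofactor m = cofactor n ->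
  (beta m = beta n -> m = n) /\
  exists2 e, d %/ H <= e & sigma (beta m) * beta n = sigma (beta n) * beta m %[mod e].
Proof.
move=> ms ns emn.
have [/andP[m0 mN] dm gm /andP[bm cm] /andP[bm1 bm2]] := sP ms.
have [/andP[n0 nN] dn gn /andP[bn cn] /andP[bn1 bn2]] := sP ns.
have mE := divnK bm; have nE := divnK bn.
rewrite -/(cofactor _) in mE nE cm cn; rewrite emn in mE cm.
split; first by move=> eb; rewrite -[LHS]mE -[RHS]nE eb.
have a0 : 0 < cofactor n by move: n0; rewrite -[X in 0 < X]nE muln_gt0 => /andP[].
apply: (@dvdn_cross (cofactor n)); rewrite ?mE ?nE //.
- by rewrite coprime_sym.
- by rewrite coprime_sym.
- by apply: dvdn_gt0 bm.
- by apply: dvdn_gt0 bn.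
- exact: leq_trans Hd.
Qed.

(** For primes the relation [(p + 1) * p' = (p' + 1) * p] reduces to [p = p'] modulo [e >= d %/ H],
    so each block of length [d %/ H] holds at most one [p] per cofactor. *)
Lemma size_dyadic_prime : {in s, forall n, prime (beta n)} ->
  size s <= (N %/ 2 ^ k).+1 * (2 ^ k.+1 %/ (d %/ H)).+1.
Proof.
move=> pb; rewrite -[leqRHS]muln1.
apply: (@size_le_triple s _ _ _ cofactor (fun n => beta n %/ (d %/ H)) (fun=> 0)) => //.
  move=> n ns; split=> //; first exact: cofactor_lt.
  by rewrite ltnS; apply: leq_div2r; case: (sP ns) => _ _ _ _ /andP[_ /ltnW].
move=> m n ms ns /(same_cofactor ms ns)[mn [e le]] + hc _.
rewrite !sigma_prime ?pb // !mulSn [beta n * _]mulnC => /eqP.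
rewrite eqn_modDr => /eqP he; apply: mn.
have := divn_eq (beta m) (d %/ H); have := divn_eq (beta n) (d %/ H).
have := ltn_pmod (beta m) e0; have := ltn_pmod (beta n) e0.
rewrite hc => r1 r2 q1 q2.
by apply/esym; apply: eqn_modulo_close he _ _; lia.
Qed.

Lemma size_dyadic_ratio (h : nat) :
    {in s, forall n, sigma (beta n) <= h * beta n} ->
  size s <= (N %/ 2 ^ k).+1 * ((4 ^ k.+1 %/ (d %/ H)).+1 * h).+1 * H.+1.
Proof.
(* [Q] is the least scale with [4 ^ k.+1 < Q * (d %/ H)]; as [beta m * beta n < 4 ^ k.+1], this is
   what [ratio_inj] requires. *)
move=> hb; set Q := (_ %/ (d %/ H)).+1.
apply: (@size_le_triple s _ _ _ cofactor (fun n => (Q * sigma (beta n)) %/ beta n)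
         (fun n => gcdn (beta n) (sigma (beta n)))) => //.
  move=> n ns; have [/andP[n0 nN] dn gn ub _] := sP ns.
  have /andP[bn cbn] := ub; have b0 : 0 < beta n by apply: dvdn_gt0 bn.
  split; first exact: cofactor_lt.
    by rewrite ltnS -(mulnK (Q * h) b0) -mulnA leq_div2r // leq_mul2l hb ?orbT.
  rewrite ltnS; apply: leq_trans gn; apply: dvdn_leq; first by rewrite gcdn_gt0 n0.
  (* Since [beta n] is unitary, [sigma (beta n)] divides [sigma n], so the gcd at [beta n] divides
     the one at [n] and inherits the bound [H]. *)
  have nE := divnK bn.
  have sE : sigma n = sigma (n %/ beta n) * sigma (beta n).
    rewrite -sigmaM ?nE 1?coprime_sym //.
    by rewrite divn_gt0 // dvdn_leq.
  by rewrite dvdn_gcd (dvdn_trans (dvdn_gcdl _ _) bn) sE dvdn_mull // dvdn_gcdr.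
move=> m n ms ns /(same_cofactor ms ns)[mn [e le he]] hc hg; apply: mn.
have [/andP[m0 _] _ _ /andP[bm _] /andP[_ bm2]] := sP ms.
have [/andP[n0 _] _ _ /andP[bn _] /andP[_ bn2]] := sP ns.
apply: (@ratio_inj _ _ Q e) => //; [exact: dvdn_gt0 bm|exact: dvdn_gt0 bn|].
apply: (@leq_trans (4 ^ k.+1)).
  by rewrite (_ : 4 = 2 * 2) // expnMn; apply: ltn_mul.
apply: (@leq_trans (Q * (d %/ H))); last by rewrite leq_mul2l le orbT.
by rewrite ltnW // ltn_ceil.
Qed.

End DyadicCount.

(** The list is cut by the dyadic size of a chosen unitary divisor, then by its primality; [B]
    bounds each of the two pieces. The extra bound [2 ^ k <= U ^ 2] is available for the non-prime
    piece. *)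
Lemma size_aliquot_multiples (d H N K U h B : nat) (s : seq nat) :
    uniq s -> 0 < H <= d -> 0 < K -> K ^ 3 <= U ->
    (forall b, 0 < b <= N -> sigma b <= h * b) ->
    {in s, forall n, [/\ U < n <= N, d %| aliquot n, gcdn n (sigma n) <= H &
       sqfree_above K n]} ->
    (forall k, 2 ^ k <= N -> U < 2 ^ k.+1 ->
       (N %/ 2 ^ k).+1 * (2 ^ k.+1 %/ (d %/ H)).+1 <= B) ->
    (forall k, 2 ^ k <= N -> U < 2 ^ k.+1 -> 2 ^ k <= U ^ 2 ->
       (N %/ 2 ^ k).+1 * ((4 ^ k.+1 %/ (d %/ H)).+1 * h).+1 * H.+1 <= B) ->
  size s <= (trunc_log 2 N).+1 * (B + B).
Proof.
move=> us /andP[H0 Hd] K0 KU hh sP hB1 hB2.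
pose good n b := unitary b n && (prime b && (U < b) || (U < b <= U ^ 2)).
have [beta hbeta] : {beta : nat -> nat & {in s, forall n, good n (beta n)}}.
  apply: (@choice _ _ (fun n b => n \in s -> good n b)) => n.
  have [ns|] := boolP (n \in s); last by exists 0.
  have [/andP[Un nN] _ _ sf] := sP n ns.
  by have [b ub hb] := unitary_divisor_between sf K0 KU Un; exists b => _; rewrite /good ub.
pose P k n := 2 ^ k <= beta n < 2 ^ k.+1.
apply: (@leq_trans (\sum_(k < (trunc_log 2 N).+1) count (P k) s)).
  apply: size_le_sum_count => n ns; have /andP[/andP[bn _] hb] := hbeta n ns.
  have [/andP[Un nN] _ _ _] := sP n ns.
  have n0 : 0 < n by lia.
  have b0 : 0 < beta n by apply: dvdn_gt0 bn.
  exists (trunc_log 2 (beta n)); last exact: trunc_log_bounds.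
  rewrite ltnS; apply: leq_trunc_log; apply: leq_trans nN; exact: dvdn_leq.
rewrite -[X in _ <= X * _](card_ord (trunc_log 2 N).+1) -sum_nat_const.
apply: leq_sum => k _; rewrite -size_filter.
set t := seq.filter _ s.
have tP n : n \in t -> [/\ n \in s, 0 < n <= N, unitary (beta n) n & P k n].
  rewrite mem_filter => /andP[Pn ns]; have [/andP[Un nN] _ _ _] := sP n ns.
  by have /andP[ub _] := hbeta n ns; split => //; rewrite nN andbT; lia.
have base n : n \in t -> [/\ 0 < n <= N, d %| aliquot n,
    gcdn n (sigma n) <= H, unitary (beta n) n & 2 ^ k <= beta n < 2 ^ k.+1].
  by move=> /tP[ns nN ub Pn]; have [_ dn gn _] := sP n ns.
have bnd n : n \in t -> [/\ 2 ^ k <= N, U < 2 ^ k.+1 & 0 < beta n <= N].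
  move=> /tP[ns /andP[n0 nN] /andP[bn _] /andP[Pn1 Pn2]].
  have /andP[_ hb] := hbeta n ns.
  have bN : beta n <= N by apply: leq_trans nN; apply: dvdn_leq.
  have Ub : U < beta n by case/orP: hb => /andP[].
  split; [exact: leq_trans Pn1 bN|exact: ltn_trans Pn2|].
  by rewrite bN andbT; lia.
pose prim n := prime (beta n).
rewrite -(count_predC prim t) -!size_filter.
have filt (p : pred nat) n : n \in seq.filter p t -> n \in t by rewrite mem_filter => /andP[].
apply: leq_add.
  (* An empty piece is trivial; a member of a non-empty one supplies the side conditions on [k]. *)
  set t1 := seq.filter _ t; have [->//|ne] := eqVneq t1 [::].
  have : {n | n \in t1} by case: (t1) ne => // n ? _; exists n; rewrite mem_head.
  move=> [n /filt nt]; have [kN Uk _] := bnd n nt.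
  apply: leq_trans (hB1 k kN Uk); apply: (@size_dyadic_prime _ _ _ _ _ beta) => //.
  - by rewrite !filter_uniq.
  - by move=> m /filt /base.
  - by move=> m; rewrite mem_filter => /andP[].
set t1 := seq.filter _ t; have [->//|] := eqVneq t1 [::].
have t1U n : n \in t1 -> 2 ^ k <= U ^ 2.
  rewrite mem_filter => /andP[np /tP[ns _ _ /andP[kb _]]].
  have /andP[_] := hbeta n ns; move: np; rewrite /= /prim => /negPf -> /= /andP[_].
  exact: leq_trans.
move=> ne; have : {n | n \in t1} by case: (t1) ne => // n ? _; exists n; rewrite mem_head.
move=> [n nt1]; have nt := filt _ _ nt1; have [kN Uk _] := bnd n nt.
apply: leq_trans (hB2 k kN Uk (t1U n nt1)).
apply: (@size_dyadic_ratio _ _ _ _ _ beta) => //.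
- by rewrite !filter_uniq.
- by move=> m /filt /base.
- by move=> m /filt /bnd[_ _]; apply: hh.
Qed.

(** * The exceptional set *)

Lemma sum_dvdn (m N : nat) : 0 < m ->
  \sum_(1 <= n < N.+1) (m %| n) = N %/ m.
Proof.
move=> m0; elim: N => [|N IH]; first by rewrite big_geq // div0n.
by rewrite big_nat_recr //= IH divnS // addnC.
Qed.

Lemma sum_logn (p N : nat) : \sum_(1 <= n < N.+1) logn p n = logn p N`!.
Proof.
elim: N => [|N IH]; first by rewrite big_geq // fact0 logn1.
by rewrite big_nat_recr //= IH factS lognM ?fact_gt0 // addnC.
Qed.


Lemma prod_pfactor (g N : nat) : 0 < g <= N ->
  \prod_(0 <= p < N.+1) p ^ logn p g = g.
Proof.
move=> /andP[g0 gN]; rewrite -[RHS]partnT // (widen_partn _ gN).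
by apply: eq_bigl => p; rewrite inE.
Qed.

(** * Harmonic sums, tails of inverse squares and prime exponents *)

Section RealSums.
Variable R : realType.
Local Open Scope ring_scope.

(** The induction step is [1 / (a + 1) <= ln (a + 1) - ln a], that is, [ln (1 - t) <= - t] at
    [t = 1 / (a + 1)]. *)
Lemma harmonic_le (N : nat) : (0 < N)%N ->
  \sum_(1 <= k < N.+1) (k%:R : R)^-1 <= 1 + ln N%:R.
Proof.
case: N => // N _; elim: N => [|N IH]; first by rewrite big_nat1 invr1 ln1 addr0.
rewrite big_nat_recr //=; apply: (le_trans (lerD IH (lexx _))).
rewrite -addrA lerD2l -lerBrDl.
have n1 : (0 : R) < N.+1%:R by rewrite ltr0n.
rewrite -[N.+2%:R]natr1; set a := N.+1%:R in n1 *.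
have x1 : (a + 1)^-1 < 1 by rewrite invf_lt1; lra.
have := @le_ln1Dx R (- (a + 1)^-1) ltac:(by rewrite ltrN2).
have -> : 1 - (a + 1)^-1 = a / (a + 1) by field; lra.
rewrite ln_div ?posrE //; lra.
Qed.

Lemma inv_sqr_tail (a b : nat) : (0 < a <= b)%N ->
  \sum_(a.+1 <= k < b.+1) (k%:R ^+ 2 : R)^-1 <= a%:R^-1.
Proof.
move=> /andP[a0 ab].
have -> : (a%:R : R)^-1 = b%:R^-1 + (a%:R^-1 - b%:R^-1) by lra.
(* The induction needs the telescoping form, based on [1 / (c + 1) ^ 2 <= 1 / c - 1 / (c + 1)]. *)
have h : \sum_(a.+1 <= k < b.+1) (k%:R ^+ 2 : R)^-1 <= a%:R^-1 - b%:R^-1.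
  elim: b ab => [|b IH] ab; first by lia.
  have [e|ne] := eqVneq a b.+1; first by rewrite big_geq ?e // subrr.
  rewrite big_nat_recr /=; last by lia.
  have {}IH := IH ltac:(lia).
  have b1 : (0 : R) < b%:R by rewrite ltr0n; lia.
  apply: (le_trans (lerD IH (lexx _))).
  rewrite -natr1 -subr_ge0; set c := b%:R in b1 *; set A := a%:R^-1.
  have -> : A - (c + 1)^-1 - (A - c^-1 + (c + 1) ^- 2) = (c * (c + 1) ^+ 2)^-1.
    by field; lra.
  by rewrite invr_ge0 mulr_ge0 ?sqr_ge0 // ltW.
by apply: (le_trans h); rewrite lerDr invr_ge0.
Qed.

Lemma ln_prod (I : Type) (r : seq I) (F : I -> R) : (forall i, 0 < F i) ->
  ln (\prod_(i <- r) F i) = \sum_(i <- r) ln (F i).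
Proof.
move=> F0; elim: r => [|i r IH]; first by rewrite !big_nil ln1.
by rewrite !big_cons lnM ?IH // posrE ?prodr_gt0.
Qed.

Lemma ln_sum_pfactor (g N : nat) : (0 < g <= N)%N ->
  ln (g%:R : R) = \sum_(0 <= p < N.+1) (logn p g)%:R * ln p%:R.
Proof.
move=> gN; rewrite -[in LHS](prod_pfactor gN) natr_prod ln_prod.
  apply: eq_bigr => p _; have [->|p0] := posnP p.
    by rewrite lognE /= expn0 ln1 mul0r.
  by rewrite natrX lnXn ?ltr0n // mulr_natl.
move=> p; rewrite ltr0n expn_gt0; have [->|//] := posnP p.
by rewrite lognE.
Qed.

(** The involution sending [d] to [n / d] turns [sigma n] into [n] times the sum of [1 / k] over [k]
    dividing [n], a part of the harmonic sum. *)
Lemma sigma_le (n : nat) : (0 < n)%N -> (sigma n)%:R <= (1 + ln n%:R) * n%:R :> R.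
Proof.
move=> n0.
have pe : perm_eq (divisors n) [seq (n %/ d)%N | d <- divisors n].
  have inv d : (d %| n)%N -> (n %/ (n %/ d))%N = d.
    by move=> dn; rewrite divnA // mulKn.
  apply: uniq_perm; rewrite ?divisors_uniq //.
    rewrite map_inj_in_uniq ?divisors_uniq // => d d'.
    rewrite -!dvdn_divisors // => dn dn' e; by rewrite -(inv d) // e inv.
  move=> d; apply/idP/mapP => [|[d' + ->]]; rewrite -!dvdn_divisors // => dn.
    by exists (n %/ d)%N; rewrite ?inv // -dvdn_divisors // dvdn_div.
  exact: dvdn_div.
rewrite /sigma (perm_big _ pe) big_map natr_sum.
have -> : \sum_(d <- divisors n) ((n %/ d)%N%:R : R) =
    n%:R * \sum_(1 <= k < n.+1 | (k %| n)%N) k%:R^-1.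
  rewrite big_distrr /= -[RHS]big_filter.
  rewrite (perm_big [seq k <- index_iota 1 n.+1 | (k %| n)%N]) /=.
    rewrite big_filter [RHS]big_filter; apply: eq_bigr => d dn.
    by rewrite natf_div.
  apply: uniq_perm; rewrite ?divisors_uniq ?filter_uniq ?iota_uniq // => d.
  rewrite mem_filter -dvdn_divisors // mem_index_iota.
  case: (boolP (d %| n)%N) => //= dn.
  by apply/esym/andP; split; [exact: dvdn_gt0 dn|rewrite ltnS; exact: dvdn_leq].
rewrite mulrC ler_pM2r ?ltr0n //; apply: le_trans (harmonic_le n0).
rewrite big_mkcond /=; apply: ler_sum => k _; case: ifP => // _.
Qed.

Lemma sum_dvdn_le (m N : nat) : (0 < m)%N ->
  \sum_(1 <= n < N.+1) ((m %| n)%:R : R) <= N%:R / m%:R.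
Proof.
move=> m0; rewrite -natr_sum sum_dvdn // ler_pdivlMr ?ltr0n // -natrM ler_nat.
exact: leq_divM.
Qed.

(** Legendre's formula for the exponent of [p] in the factorial of [N], with the floors dropped,
    leaves a geometric series. *)
Lemma sum_logn_le (p N : nat) : prime p ->
  \sum_(1 <= n < N.+1) ((logn p n)%:R : R) <= N%:R / p.-1%:R.
Proof.
move=> pp; have p1 := prime_gt1 pp.
rewrite -natr_sum sum_logn logn_fact // natr_sum.
have q0 : (0 : R) < p%:R - 1 by rewrite subr_gt0 ltr1n.
have -> : (p.-1%:R : R) = p%:R - 1 by rewrite -subn1 natrB // ltnW.
apply: (@le_trans _ _ (\sum_(1 <= k < N.+1) N%:R * (p%:R ^- k))).
  apply: ler_sum => k _; rewrite ler_pdivlMr ?exprn_gt0 ?ltr0n ?prime_gt0 //.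
  by rewrite -natrX -natrM ler_nat leq_divM.
rewrite -big_distrr /= ler_wpM2l // .
have -> : \sum_(1 <= k < N.+1) (p%:R ^- k : R) = (1 - p%:R ^- N) / (p%:R - 1).
  elim: N => [|N IH]; first by rewrite big_geq // expr0 invr1 subrr mul0r.
  rewrite big_nat_recr //= IH exprS; field.
  by rewrite lt0r_neq0 // expf_neq0 // pnatr_eq0 -lt0n prime_gt0.
rewrite ler_pdivrMr // mulVf ?lt0r_neq0 // gerBl invr_ge0 exprn_ge0 //.
Qed.

End RealSums.

Definition exceptional (K H N n : nat) : bool :=
  [|| n * K <= N, ~~ `[< sqfree_above K n >] | H < gcdn n (sigma n)].

(** * First moment of the logarithm of the gcd, and the size of the exceptional set *)

Section ExceptionalCount.
Variable R : realType.
Local Open Scope ring_scope.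

Let gcds n := gcdn n (sigma n).

(** Replacing the gcd by [n] itself is affordable for the primes up to [K ^ 6]. *)
Lemma sum_logn_gcd_small (K N p : nat) : prime p ->
  \sum_(1 <= n < N.+1 | `[< sqfree_above K n >]) ((logn p (gcds n))%:R : R) <=
  N%:R / p.-1%:R.
Proof.
move=> pp; apply: le_trans (sum_logn_le R N pp).
rewrite big_mkcond /= big_nat_cond [leRHS]big_nat_cond.
apply: ler_sum => n /andP[/andP[n0 _] _]; case: ifP => _; last exact: ler0n.
by rewrite ler_nat dvdn_leq_log // dvdn_gcdl.
Qed.

(** Sum [logn_gcd_sigma] over [n] first: each [k] contributes at most [N / (p * (k * p - 1)) <= 2 *
    N / (k * p ^ 2)], because [k * p >= 2]. *)
Lemma sum_logn_gcd_large (K N p : nat) : prime p -> (0 < K)%N -> (0 < N)%N ->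
  (K ^ 6 < p)%N ->
  \sum_(1 <= n < N.+1 | `[< sqfree_above K n >]) ((logn p (gcds n))%:R : R) <=
  2 * N%:R * (1 + ln N%:R) * (p%:R ^+ 2)^-1.
Proof.
move=> pp K0 N0 Kp; have p1 := prime_gt1 pp.
have pR : (0 : R) < p%:R by rewrite ltr0n ltnW.
apply: (@le_trans _ _ (\sum_(1 <= n < N.+1) \sum_(1 <= k < N.+1)
    ((p * (k * p).-1 %| n)%N%:R : R))).
  rewrite big_mkcond /= big_nat_cond [leRHS]big_nat_cond.
  apply: ler_sum => n /andP[nN _]; case: ifP => [/asboolP sf|_].
    by rewrite -natr_sum ler_nat; exact: logn_gcd_sigma sf pp Kp K0.
  by apply: sumr_ge0.
rewrite exchange_big_nat /=.
apply: (@le_trans _ _ (\sum_(1 <= k < N.+1) 2 * N%:R * (p%:R ^+ 2)^-1 * k%:R^-1)).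
  rewrite big_nat_cond [leRHS]big_nat_cond.
  apply: ler_sum => k /andP[/andP[k0 _] _].
  have kp : (1 < k * p)%N by nia.
  apply: (le_trans (sum_dvdn_le _ _ _)); first by rewrite muln_gt0; lia.
  have kR : (0 : R) < k%:R by rewrite ltr0n.
  have -> : 2 * N%:R * (p%:R ^+ 2)^-1 * k%:R^-1 = N%:R / (p%:R * (k%:R * p%:R / 2)) :> R.
    by field; lra.
  rewrite ler_wpM2l // lef_pV2 ?posrE; last 2 first.
    by rewrite ltr0n muln_gt0; lia.
    by rewrite !mulr_gt0 // invr_gt0.
  rewrite natrM ler_pM2l // -subn1 natrB ?natrM; last by lia.
  have : (2 : R) <= k%:R * p%:R by rewrite -natrM ler_nat.
  lra.
rewrite -big_distrr /= -!mulrA ler_wpM2l // ler_wpM2l // [leRHS]mulrC.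
by rewrite ler_wpM2l ?harmonic_le // invr_ge0 sqr_ge0.
Qed.

(** Expand the logarithm over primes and exchange the sums. Primes up to [K ^ 6] give a harmonic
    sum, larger ones a tail of inverse squares. *)
Lemma sum_ln_gcd (K N : nat) : (0 < K)%N -> (K ^ 6 <= N)%N ->
  \sum_(1 <= n < N.+1 | `[< sqfree_above K n >]) ln ((gcds n)%:R : R) <=
  N%:R * (ln (K ^ 6)%:R * (1 + ln (K ^ 6)%:R) +
          2 * (1 + ln N%:R) * ln N%:R / (K ^ 6)%:R).
Proof.
move=> K0; set Y := (K ^ 6)%N => YN.
have Y0 : (0 < Y)%N by rewrite expn_gt0 K0.
have N0 : (0 < N)%N by lia.
have lnY : 0 <= ln Y%:R :> R by rewrite ln_ge0 // ler1n.
have lnN : 0 <= ln N%:R :> R by rewrite ln_ge0 // ler1n.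
pose T p : R := \sum_(1 <= n < N.+1 | `[< sqfree_above K n >]) (logn p (gcds n))%:R.
have T0 p : 0 <= T p by apply: sumr_ge0.
have Tnp p : ~~ prime p -> T p = 0.
  by move=> np; apply: big1 => n _; rewrite lognE (negPf np).
have -> : \sum_(1 <= n < N.+1 | `[< sqfree_above K n >]) ln ((gcds n)%:R : R) =
    \sum_(0 <= p < N.+1) T p * ln p%:R.
  under [RHS]eq_bigr do rewrite /T big_distrl /=.
  rewrite [RHS]exchange_big_nat /= big_nat_cond [RHS]big_nat_cond.
  apply: eq_bigr => n /andP[/andP[n0 nN] _]; apply: ln_sum_pfactor.
  by rewrite gcdn_gt0 n0 /= (leq_trans (dvdn_leq n0 (dvdn_gcdl _ _))).
rewrite (big_cat_nat (n := Y.+1)) //= mulrDr; apply: lerD.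
  (* The terms at 0 and 1 vanish; shifting the index by one turns the denominators [p.-1] into the
     consecutive integers of a harmonic sum. *)
  rewrite big_ltn // big_ltn // !Tnp // !mul0r !add0r big_add1 /=.
  apply: (@le_trans _ _ (\sum_(1 <= p < Y.+1) N%:R * ln Y%:R * p%:R^-1)); last first.
    rewrite -big_distrr /= -!mulrA ler_wpM2l // ler_wpM2l //; exact: harmonic_le.
  rewrite [leRHS]big_nat_recr //= -[leLHS]addr0; apply: lerD; last first.
    by rewrite !mulr_ge0 ?invr_ge0.
  rewrite big_nat_cond [leRHS]big_nat_cond.
  apply: ler_sum => p /andP[/andP[p0 pY] _].
  have pR : (0 : R) < p%:R by rewrite ltr0n.
  have [pp|np] := boolP (prime p.+1); last first.
    by rewrite Tnp // mul0r !mulr_ge0 ?invr_ge0.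
  rewrite mulrAC; apply: ler_pM => //; first by rewrite ln_ge0 // ler1n.
    exact: sum_logn_gcd_small.
  by rewrite ler_ln ?posrE ?ltr0n // ler_nat.
apply: (@le_trans _ _ (\sum_(Y.+1 <= p < N.+1)
    2 * N%:R * (1 + ln N%:R) * ln N%:R * (p%:R ^+ 2)^-1)).
  rewrite big_nat_cond [leRHS]big_nat_cond.
  apply: ler_sum => p /andP[/andP[Yp pN] _].
  have p0 : (0 < p)%N by lia.
  have [pp|np] := boolP (prime p); last first.
    by rewrite Tnp // mul0r !mulr_ge0 ?addr_ge0 ?invr_ge0 ?sqr_ge0.
  rewrite [leRHS]mulrAC; apply: ler_pM => //; first by rewrite ln_ge0 // ler1n.
    exact: (sum_logn_gcd_large pp K0 N0).
  by rewrite ler_ln ?posrE ?ltr0n // ler_nat.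
rewrite -big_distrr /=.
have -> : N%:R * (2 * (1 + ln N%:R) * ln N%:R / Y%:R) =
  2 * N%:R * (1 + ln N%:R) * ln N%:R * Y%:R^-1 :> R by ring.
rewrite ler_wpM2l ?mulr_ge0 ?addr_ge0 //.
by apply: inv_sqr_tail; rewrite Y0.
Qed.

(** A union bound: small [n] and large square divisors cost [N / K] each. On the remaining [n],
    Markov's inequality bounds the indicator of a gcd above [H] by its logarithm over [ln H.+1]. *)
Lemma count_exceptional (K H N : nat) :
    (0 < K)%N -> (0 < H)%N -> (K ^ 6 <= N)%N ->
  (count (exceptional K H N) (iota 1 N))%:R <=
  N%:R * (2 / K%:R + (ln (K ^ 6)%:R * (1 + ln (K ^ 6)%:R) +
          2 * (1 + ln N%:R) * ln N%:R / (K ^ 6)%:R) / ln H.+1%:R) :> R.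
Proof.
move=> K0 H0 KN; set B := _ + _ / (K ^ 6)%:R.
have KR : (0 : R) < K%:R by rewrite ltr0n.
have N0 : (0 < N)%N by apply: leq_trans KN; rewrite expn_gt0 K0.
have KleN : (K <= N)%N.
  by apply: leq_trans KN; rewrite -[leqLHS]expn1 leq_pexp2l.
have lnH : 0 < ln (H.+1%:R : R) by rewrite ln_gt0 // ltr1n ltnS.
rewrite (_ : (count _ _)%:R = \sum_(1 <= n < N.+1) ((exceptional K H N n)%:R : R)); last first.
  by rewrite -natr_sum -sum1_count /index_iota subn1 /= big_mkcond; congr _%:R;
    apply: eq_bigr => n _; case: exceptional.
apply: (@le_trans _ _ (\sum_(1 <= n < N.+1) ((n * K <= N)%N%:R +
    \sum_(K.+1 <= k < N.+1) ((k ^ 2 %| n)%N%:R) +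
    (if `[< sqfree_above K n >] then ln (gcds n)%:R / ln H.+1%:R else 0 : R)))).
  rewrite big_nat_cond [leRHS]big_nat_cond.
  apply: ler_sum => n /andP[/andP[n0 nN] _].
  have g0 : (0 < gcds n)%N by rewrite gcdn_gt0 n0.
  have lg0 : 0 <= ln ((gcds n)%:R : R) by rewrite ln_ge0 // ler1n.
  have t0 : 0 <= \sum_(K.+1 <= k < N.+1) ((k ^ 2 %| n)%N%:R : R) by apply: sumr_ge0.
  rewrite /exceptional; case: (n * K <= N)%N => /=.
    rewrite -addrA lerDl addr_ge0 //; case: ifP => // _.
    by rewrite divr_ge0 // ltW.
  rewrite add0r; case: asboolP => [sf|nsf] /=.
    apply: ler_wpDl => //; case: ltnP => /= Hg; last by rewrite divr_ge0 // ltW.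
    rewrite ler_pdivlMr // mul1r ler_ln ?posrE ?ltr0n // ler_nat //.
  rewrite addr0; have [k Kk kn] : exists2 k, (K < k)%N & (k ^ 2 %| n)%N.
    apply: contrapT => h; apply: nsf => k Kk; apply/negP => kn; apply: h.
    by exists k.
  have kN : (k < N.+1)%N.
    by have := dvdn_leq n0 kn; rewrite expnS expn1; nia.
  rewrite (big_cat_nat (n := k)) //=; last by lia.
  rewrite [X in _ + X]big_ltn // kn /= addrCA lerDl addr_ge0 //; exact: sumr_ge0.
rewrite !big_split /=.
have h1 : \sum_(1 <= n < N.+1) ((n * K <= N)%N%:R : R) <= N%:R / K%:R.
  rewrite -natr_sum ler_pdivlMr // -natrM ler_nat.
  apply: (@leq_trans (N %/ K * K)); last exact: leq_divM.
  rewrite leq_mul2r; apply/orP; right.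
  have DN : (N %/ K <= N)%N by apply: leq_div.
  rewrite (big_cat_nat (n := (N %/ K).+1)) //=.
  rewrite [X in (_ + X)%N]big1_seq; last first.
    move=> n /andP[_]; rewrite mem_index_iota => /andP[lt _].
    by rewrite -leq_divRL // leqNgt lt.
  rewrite addn0; apply: (@leq_trans (\sum_(1 <= n < (N %/ K).+1) 1)).
    by apply: leq_sum => n _; exact: leq_b1.
  by rewrite sum_nat_const_nat muln1 subn1.
have h2 : \sum_(1 <= n < N.+1) \sum_(K.+1 <= k < N.+1) ((k ^ 2 %| n)%N%:R : R) <=
    N%:R / K%:R.
  rewrite exchange_big_nat /=.
  apply: (@le_trans _ _ (\sum_(K.+1 <= k < N.+1) N%:R * (k%:R ^+ 2)^-1)).
    rewrite big_nat_cond [leRHS]big_nat_cond; apply: ler_sum => k /andP[/andP[k0 _] _].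
    by rewrite -natrX; apply: sum_dvdn_le; rewrite expn_gt0; lia.
  by rewrite -big_distrr /= ler_wpM2l // inv_sqr_tail // K0.
have h3 : \sum_(1 <= n < N.+1) (if `[< sqfree_above K n >]
    then ln ((gcds n)%:R : R) / ln H.+1%:R else 0) <= N%:R * (B / ln H.+1%:R).
  rewrite -big_mkcond -big_distrl /= mulrA ler_wpM2r ?invr_ge0 ?(ltW lnH) //.
  exact: sum_ln_gcd.
apply: (le_trans (lerD (lerD h1 h2) h3)); rewrite le_eqVlt; apply/orP; left.
by apply/eqP; field; rewrite !lt0r_neq0.
Qed.

End ExceptionalCount.

(** * Numerical bounds *)

Section RealCount.
Variable R : realType.
Local Open Scope ring_scope.

Lemma natr_divn_le (m e : nat) (c : R) : 0 < c -> c <= e%:R ->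
  (m %/ e)%N%:R <= m%:R / c.
Proof.
move=> c0 ce; rewrite ler_pdivlMr //.
apply: (@le_trans _ _ ((m %/ e)%N%:R * e%:R)); first by rewrite ler_wpM2l.
by rewrite -natrM ler_nat leq_divM.
Qed.

(** [size_aliquot_multiples] is applied with [U] the integer part of [y ^ 12]; the modulus is then
    at least [y ^ 39 / 2], while [2 ^ k] exceeds [y ^ 12 / 2]. *)
Lemma size_aliquot_multiples_real (x y : R) (d H K h : nat) (s : seq nat) :
    1 <= x -> 1 <= y -> d%:R = y ^+ 40 -> (0 < H)%N -> H%:R <= y ->
    (0 < K)%N -> K%:R ^+ 3 <= y -> (0 < h)%N ->
    (forall b, (0 < b <= Num.truncn x)%N -> (sigma b <= h * b)%N) ->
    uniq s ->
    {in s, forall n, [/\ (Num.truncn (y ^+ 12) < n <= Num.truncn x)%N,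
       (d %| aliquot n)%N, (gcdn n (sigma n) <= H)%N & sqfree_above K n]} ->
  (size s)%:R <=
    (trunc_log 2 (Num.truncn x)).+1%:R * (160 * h%:R * x / y ^+ 11).
Proof.
move=> x1 y1 dE H0 Hy K0 Ky h0 hh us sP.
have x0 : 0 < x by lra.
have y0 : 0 < y by lra.
have hR : 1 <= h%:R :> R by rewrite ler1n.
have yX n : 1 <= y ^+ n by rewrite exprn_ege1.
have yX0 n : 0 < y ^+ n by rewrite exprn_gt0.
have Hd : (H <= d)%N.
  by rewrite -(ler_nat R) dE (le_trans Hy) // exprS ler_peMr // ltW.
have eB : y ^+ 39 / 2 <= (d %/ H)%N%:R.
  have e0 : (0 < d %/ H)%N by rewrite divn_gt0.
  have : (d <= 2 * (d %/ H) * H)%N by have := ltn_ceil d H0; nia.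
  rewrite -(ler_nat R) dE !natrM => le.
  rewrite ler_pdivrMr // -(ler_pM2r y0) -exprSr (le_trans le) //.
  by rewrite [_ * 2]mulrC ler_wpM2l // mulr_ge0.
have y39 : 0 < y ^+ 39 / 2 by rewrite divr_gt0.
pose B := Num.truncn (80 * h%:R * x / y ^+ 11).
have B0 : 0 <= 80 * h%:R * x / y ^+ 11 by rewrite divr_ge0 ?mulr_ge0 // ltW.
have BR : B%:R <= 80 * h%:R * x / y ^+ 11 by rewrite truncn_le.
(* The added 1 costs only a factor 2, because [x / 2 ^ k >= 1]. *)
have cofB k : (2 ^ k <= Num.truncn x)%N ->
    (Num.truncn x %/ 2 ^ k).+1%:R <= 2 * x / 2 ^+ k :> R.
  move=> kN; have z0 : (0 : R) < 2 ^+ k by rewrite exprn_gt0.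
  have kx : 2 ^+ k <= x.
    by rewrite -natrX; move: kN; rewrite truncn_ge_nat // ltW.
  have a : (Num.truncn x %/ 2 ^ k)%N%:R <= x / 2 ^+ k.
    apply: (le_trans (natr_divn_le _ z0 _)); first by rewrite natrX.
    by rewrite ler_wpM2r ?invr_ge0 ?(ltW z0) // truncn_le ltW.
  have b : 1 <= x / 2 ^+ k by rewrite ler_pdivlMr // mul1r.
  rewrite -natr1 -mulrA; lra.
have zB k : (Num.truncn (y ^+ 12) < 2 ^ k.+1)%N -> y ^+ 12 < 2 * 2 ^+ k.
  by rewrite truncn_lt_nat ?(ltW (yX0 _)) // natrX [ltRHS]exprS.
have inv_zB k : y ^+ 12 < 2 * 2 ^+ k -> (2 ^+ k : R)^-1 <= 2 / y ^+ 12.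
  move=> lt; have z0 : (0 : R) < 2 ^+ k by rewrite exprn_gt0.
  by rewrite ler_pdivlMr // mulrC ler_pdivrMr // ltW.
have hN : (size s <= (trunc_log 2 (Num.truncn x)).+1 * (B + B))%N.
  apply: (@size_aliquot_multiples d H _ K (Num.truncn (y ^+ 12)) h) => //.
  - by rewrite H0.
  - rewrite truncn_ge_nat ?(ltW (yX0 _)) // natrX (le_trans Ky) //.
    by rewrite exprS ler_peMr // ltW.
  (* Prime case: the bound is [x * (8 / y ^ 39 + 2 / 2 ^ k)], of order [x / y ^ 12]. *)
  - move=> k kN /zB lt; rewrite truncn_ge_nat // natrM.
    have z0 : (0 : R) < 2 ^+ k by rewrite exprn_gt0.
    have := natr_divn_le (2 ^ k.+1) y39 eB; rewrite natrX [2%:R ^+ _]exprS => q1.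
    apply: (@le_trans _ _ (2 * x / 2 ^+ k * (2 * 2 ^+ k / (y ^+ 39 / 2) + 1))).
      by apply: ler_pM => //; [exact: cofB|rewrite -natr1 lerD2r].
    have -> : 2 * x / 2 ^+ k * (2 * 2 ^+ k / (y ^+ 39 / 2) + 1) =
        x * (8 / y ^+ 39 + 2 * (2 ^+ k)^-1) :> R.
      move: (2 ^+ k) (y ^+ 39) z0 (yX0 39) => z Y z0 Y0.
      by field; rewrite !lt0r_neq0.
    have i39 : (y ^+ 39)^-1 <= (y ^+ 11)^-1.
      by rewrite lef_pV2 ?posrE // ler_weXn2l.
    have i12 : (y ^+ 12)^-1 <= (y ^+ 11)^-1.
      by rewrite lef_pV2 ?posrE // ler_weXn2l.
    have iz := inv_zB k lt.
    have I0 : 0 <= (y ^+ 11)^-1 by rewrite invr_ge0 ltW.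
    have -> : 80 * h%:R * x / y ^+ 11 = x * (h%:R * (80 * (y ^+ 11)^-1)).
      by move: (y ^+ 11)^-1 => I; ring.
    rewrite ler_pM2l //.
    apply: (@le_trans _ _ (1 * (80 * (y ^+ 11)^-1))); last first.
      by rewrite ler_wpM2r // mulr_ge0.
    lra.
  (* Ratio case: the gcd costs a factor [2 * y]. As [z = 2 ^ k] lies between [y ^ 12 / 2] and
     [y ^ 24], both [8 * z / y ^ 39] and [1 / z] are [O(1 / y ^ 12)]; the constant 80 is
     [8 * (8 + 2)]. *)
  - move=> k kN /zB lt kU; rewrite truncn_ge_nat // !natrM.
    set z : R := 2 ^+ k; have z0 : 0 < z by rewrite exprn_gt0.
    have zy : z <= y ^+ 24.
      have U12 : (Num.truncn (y ^+ 12))%:R <= y ^+ 12 by rewrite truncn_le ltW.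
      rewrite -[24%N]/((12 * 2)%N) exprM /z -natrX.
      by apply: (@le_trans _ _ ((Num.truncn (y ^+ 12) ^ 2)%N%:R));
        rewrite ?ler_nat // natrX lerXn2r ?nnegrE ?(ltW (yX0 _)).
    have := natr_divn_le (4 ^ k.+1) y39 eB.
    have -> : (4 ^ k.+1)%N%:R = 4 * z ^+ 2 :> R.
      have -> : (4 ^ k.+1 = 4 * (2 ^ k) ^ 2)%N.
        by rewrite expnS (expnMn 2 2) mulnn.
      by rewrite natrM !natrX.
    have -> : 4 * z ^+ 2 / (y ^+ 39 / 2) = 8 * z ^+ 2 / y ^+ 39.
      by move: (y ^+ 39) (yX0 39) => Y Y0; field; rewrite lt0r_neq0.
    set q := (_ %/ _)%N; set r := 8 * z ^+ 2 / y ^+ 39 => qr.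
    have r0 : 0 <= r by apply: divr_ge0; [apply: mulr_ge0; rewrite ?sqr_ge0|exact: ltW].
    have qh : (q.+1 * h).+1%:R <= 2 * (r + 1) * h%:R.
      rewrite -natr1 natrM -natr1.
      have a1 : (q%:R + 1) * h%:R <= (r + 1) * h%:R by rewrite ler_wpM2r // lerD2r.
      have a2 : 1 <= (r + 1) * h%:R by rewrite -[leLHS]mulr1 ler_pM //; lra.
      lra.
    have Hy2 : H.+1%:R <= 2 * y by rewrite -natr1; lra.
    apply: (@le_trans _ _ (2 * x / z * (2 * (r + 1) * h%:R) * (2 * y))).
      apply: ler_pM => //.
      by apply: ler_pM => //; exact: cofB.
    have -> : 2 * x / z * (2 * (r + 1) * h%:R) * (2 * y) =
        8 * h%:R * x * (y * (8 * z / y ^+ 39 + z^-1)).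
      rewrite /r; move: (y ^+ 39) (yX0 39) => Y Y0.
      by field; rewrite !lt0r_neq0.
    have -> : 80 * h%:R * x / y ^+ 11 = 8 * h%:R * x * (10 / y ^+ 11).
      by move: (y ^+ 11)^-1 => I; ring.
    rewrite ler_wpM2l //; first by rewrite !mulr_ge0 // ltW.
    have -> : 10 / y ^+ 11 = y * (8 / y ^+ 12 + 2 / y ^+ 12).
      rewrite [y ^+ 12]exprS; move: (y ^+ 11) (yX0 11) => Y Y0.
      by field; rewrite !lt0r_neq0.
    rewrite ler_pM2l //; apply: lerD; last exact: inv_zB lt.
    rewrite -mulrA ler_pM2l // ler_pdivrMr //.
    have -> : (y ^+ 12)^-1 * y ^+ 39 = y ^+ 27.
      by rewrite -[39%N]/((12 + 27)%N) exprD mulKf // lt0r_neq0.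
    by apply: (le_trans zy); rewrite ler_weXn2l.
apply: (@le_trans _ _ ((trunc_log 2 (Num.truncn x)).+1%:R * (B + B)%:R)).
  by rewrite -natrM ler_nat.
rewrite ler_wpM2l // natrD; lra.
Qed.
End RealCount.

(** * Choice of [K] and [H], and estimates for large [x] *)

Section LargeParameter.
Variable R : realType.
Local Open Scope ring_scope.

(** Write [expR z] as the [k.+1]-st power of [expR (z / k.+1)], which is at least [z / k.+1]; the
    spare factor [z] absorbs the denominator. *)
Lemma expR_ge_exp (k : nat) (z : R) : k.+1%:R ^+ k.+1 <= z -> z ^+ k <= expR z.
Proof.
move=> kz; have k0 : (0 : R) < k.+1%:R by rewrite ltr0n.
have z0 : 0 < z by apply: lt_le_trans kz; rewrite exprn_gt0.
have -> : expR z = expR (z / k.+1%:R) ^+ k.+1.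
  by rewrite -expRM_natl mulrC divfK // lt0r_neq0.
apply: (@le_trans _ _ ((z / k.+1%:R) ^+ k.+1)); last first.
  rewrite lerXn2r ?nnegrE ?expR_ge0 ?divr_ge0 ?(ltW z0) //.
  by apply: le_trans (expR_ge1Dx _); rewrite lerDr.
rewrite expr_div_n ler_pdivlMr ?exprn_gt0 // [leRHS]exprSr ler_wpM2l //.
by rewrite exprn_ge0 // ltW.
Qed.

Lemma ln_le_self (z : R) : 0 < z -> ln z <= z.
Proof.
move=> z0; have := @le_ln1Dx R (z - 1) ltac:(lra).
rewrite addrC subrK; lra.
Qed.

Lemma trunc_log2_le (N : nat) : (0 < N)%N -> (trunc_log 2 N)%:R <= 2 * ln (N%:R : R).
Proof.
move=> N0; set t := trunc_log 2 N.
(* This is [ln (1 / 2) <= - 1 / 2]. *)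
have l2 : 1 <= 2 * ln 2 :> R.
  have := @le_ln1Dx R (- 2^-1) ltac:(lra).
  have -> : 1 - 2^-1 = 2^-1 :> R by lra.
  rewrite lnV ?posrE //; lra.
have : ln ((2 ^ t)%N%:R : R) <= ln N%:R.
  by rewrite ler_ln ?posrE ?ltr0n ?expn_gt0 // ler_nat trunc_logP.
rewrite natrX lnXn // -[X in X <= _]mulr_natl => le.
have : t%:R * 1 <= t%:R * (2 * ln 2) :> R by rewrite ler_wpM2l.
rewrite mulr1 => /le_trans; apply; rewrite mulrCA ler_pM2l //.
Qed.

Lemma aliquot_gt0 (n : nat) : (1 < n)%N -> (0 < aliquot n)%N.
Proof.
move=> n1; rewrite /aliquot big_mkcond /= (bigD1_seq 1%N) ?divisors_uniq //=.
  by rewrite n1.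
by rewrite -dvdn_divisors // ltnW.
Qed.

Definition paramK (x : R) := Num.truncn (ln x).
(** The exponent is one fortieth of the one in the lower bound for [d], so that
    [thresholdH x <= d ^ (1 / 40)]. *)
Definition thresholdH (x : R) := x `^ (1 / (80 * ln (ln (ln x)))).
Definition paramH (x : R) := Num.truncn (thresholdH x).
Definition exceptional_set (x : R) : {fset nat} :=
  [fset n in upto x | exceptional (paramK x) (paramH x) (Num.truncn x) n]%fset.

Section Estimates.
Variable x : R.
Let w := ln x.
Let q := ln w.
(** The constant is the one that [expR_ge_exp] asks for at exponent 6; it serves for [w ^ 6 <= x]
    and also covers [q ^ 5 <= w]. *)
Hypothesis q_huge : 7 ^+ 7 <= q.

Let q_large : 300 <= q.
Proof.
apply: le_trans q_huge; apply: (@le_trans _ _ (7 ^+ 3)).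
  by rewrite -natrX ler_nat.
by rewrite ler_weXn2l // ler1n.
Qed.

Let w_pos : 0 < w.
Proof.
(* [lra] skips section facts that carry a body, so they are restated. *)
have ql := q_large.
by rewrite ltNge; apply/negP => /ln0 e; move: q_large; rewrite /q e; lra.
Qed.

Let x_pos : 0 < x.
Proof. by rewrite ltNge; apply/negP => /ln0 e; move: w_pos; rewrite /w e ltxx. Qed.

Let wE : w = expR q. Proof. by rewrite lnK // posrE. Qed.
Let xE : x = expR w. Proof. by rewrite lnK // posrE. Qed.

Let wq : q ^+ 5 <= w.
Proof.
rewrite wE; apply: expR_ge_exp; apply: le_trans q_huge.
apply: (@le_trans _ _ (7 ^+ 6)); last by rewrite ler_weXn2l // ler1n.
by rewrite lerXn2r ?nnegrE // ler_nat.
Qed.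

Let q_pow (k : nat) : 1 <= q ^+ k.
Proof.
have ql := q_large.
by rewrite exprn_ege1 //; lra. Qed.

Let qw : q <= w.
Proof.
have ql := q_large.
by apply: le_trans wq; rewrite exprS ler_peMr ?q_pow //; lra. Qed.

Let w_large : 300 <= w. Proof. exact: le_trans qw. Qed.

Let wx : w ^+ 6 <= x.
Proof.
rewrite xE; apply: expR_ge_exp; exact: le_trans qw.
Qed.

Let x_large : w <= x.
Proof.
have ql := q_large; have wl := w_large.
by apply: le_trans wx; rewrite exprS ler_peMr ?exprn_ege1 //; lra. Qed.

Let K := paramK x.

Let KleW : K%:R <= w. Proof. by rewrite truncn_le ltW. Qed.

Let Kge : w / 2 <= K%:R.
Proof.
have ql := q_large; have wl := w_large.
have /andP[_] := truncn_itv (ltW w_pos); rewrite -/(paramK x) -/K -natr1; lra.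
Qed.

Let lnq_pos : 0 < ln q. Proof.
have ql := q_large; have wl := w_large.
by rewrite ln_gt0 //; lra. Qed.

Let ln_threshold : ln (thresholdH x) = w / (80 * ln q).
Proof. by rewrite /thresholdH ln_powR -/w -/q; field; rewrite lt0r_neq0. Qed.

Let threshold_pos : 0 < thresholdH x.
Proof. by rewrite /thresholdH powR_gt0. Qed.

Let ln_threshold_ge : w / (80 * q) <= ln (thresholdH x).
Proof.
have ql := q_large; have wl := w_large.
rewrite ln_threshold ler_pM2l // lef_pV2 ?posrE ?mulr_gt0 //; last by lra.
by rewrite ler_pM2l // ln_le_self //; lra.
Qed.

(** After taking logarithms this is [3 * q <= w / (80 * q)], which follows from [w >= q ^ 5]. *)
Let w_threshold : w ^+ 3 <= thresholdH x.
Proof.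
have ql := q_large; have wl := w_large.
rewrite -ler_ln ?posrE ?exprn_gt0 //; apply: le_trans ln_threshold_ge.
rewrite lnXn // -/q ler_pdivlMr ?mulr_gt0 //; last by lra.
apply: le_trans wq; rewrite -[q *+ 3]mulr_natl exprS.
have -> : 3%:R * q * (80 * q) = q * (240 * q) by ring.
rewrite ler_pM2l; last by lra.
have := q_pow 2; rewrite [q ^+ 4]exprS => h.
rewrite mulrC ler_pM2l; last by lra.
rewrite exprS; have : q * 1 <= q * q ^+ 2 by rewrite ler_pM2l //; lra.
lra.
Qed.

Let threshold_ge1 : 1 <= thresholdH x.
Proof.
have ql := q_large; have wl := w_large.
by apply: le_trans w_threshold; rewrite exprn_ege1 //; lra. Qed.

Let H := paramH x.

Let H_pos : (0 < H)%N. Proof. by rewrite truncn_gt0. Qed.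
Let K_pos : (0 < K)%N. Proof.
have ql := q_large; have wl := w_large.
by rewrite truncn_gt0 -/w; lra. Qed.

Let NleX : (Num.truncn x)%:R <= x. Proof. by rewrite truncn_le ltW. Qed.
Let N_pos : (0 < Num.truncn x)%N. Proof.
have ql := q_large; have wl := w_large.
by rewrite truncn_gt0; have := x_large; lra. Qed.

Let lnN_le : ln (Num.truncn x)%:R <= w.
Proof. by rewrite ler_ln ?posrE ?ltr0n. Qed.

Let K6leN : (K ^ 6 <= Num.truncn x)%N.
Proof.
rewrite truncn_ge_nat ?(ltW x_pos) // natrX; apply: le_trans wx.
by rewrite lerXn2r ?nnegrE ?(ltW w_pos).
Qed.

(** Since [ln K <= q], the first moment is [O(q ^ 2)] per integer, whereas [ln H.+1 >= w / (80 * q)]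
    with [w >= q ^ 5]. This term and [2 / K] are each at most [1 / q]. *)
Lemma card_exceptional_set : #|` exceptional_set x|%:R / x <= 2 / q.
Proof.
have ql := q_large; have wl := w_large.
have q0 : 0 < q by lra.
have cardE : (#|` exceptional_set x| <=
    count (exceptional K H (Num.truncn x)) (iota 1 (Num.truncn x)))%N.
  rewrite -size_filter; apply: uniq_leq_size; first exact: fset_uniq.
  move=> n; rewrite mem_filter => /=; rewrite !inE /= => /andP[-> ->] //.
rewrite ler_pdivrMr //.
apply: (@le_trans _ _ ((count (exceptional K H (Num.truncn x))
  (iota 1 (Num.truncn x)))%:R)); first by rewrite ler_nat.
apply: (le_trans (count_exceptional R K_pos H_pos K6leN)).
set L := ln (K ^ 6)%:R; set M := ln (Num.truncn x)%:R.
have K1 : (1 : R) <= K%:R by rewrite ler1n.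
have K0 : (0 : R) < K%:R by lra.
have L0 : 0 <= L by rewrite ln_ge0 // ler1n expn_gt0 K_pos.
have M0 : 0 <= M by rewrite ln_ge0 // ler1n.
have Lq : L <= 6 * q.
  rewrite /L natrX lnXn // -[X in X <= _]mulr_natl ler_pM2l //.
  by rewrite ler_ln ?posrE.
have t1 : L * (1 + L) <= 42 * q ^+ 2.
  have -> : 42 * q ^+ 2 = (6 * q) * (7 * q) by ring.
  by apply: ler_pM => //; lra.
have t2 : 2 * (1 + M) * M / (K ^ 6)%:R <= q ^+ 2.
  have a : 2 * (1 + M) * M <= 4 * w ^+ 2.
    have -> : 4 * w ^+ 2 = (4 * w) * w by ring.
    have lM : M <= w by exact: lnN_le.
    by apply: ler_pM => //; lra.
  have b : 4 * w ^+ 2 <= (K ^ 6)%:R.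
    rewrite natrX; apply: (@le_trans _ _ ((w / 2) ^+ 6)); last first.
      by rewrite lerXn2r ?nnegrE //; lra.
    have -> : (w / 2) ^+ 6 = w ^+ 2 * (w / 64 * w ^+ 3) by field.
    rewrite mulrC ler_pM2l ?exprn_gt0 //.
    have h : 1 <= w ^+ 3 by rewrite exprn_ege1 //; lra.
    have : w / 64 * 1 <= w / 64 * w ^+ 3 by rewrite ler_pM2l //; lra.
    lra.
  apply: (@le_trans _ _ 1); last exact: q_pow.
  rewrite ler_pdivrMr ?ltr0n ?expn_gt0 ?K_pos // mul1r; exact: le_trans b.
have lH : w / (80 * q) <= ln H.+1%:R.
  apply: (le_trans ln_threshold_ge); rewrite ler_ln ?posrE ?ltr0n // ltW //.
  by have /andP[_] := truncn_itv (ltW threshold_pos).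
have wq0 : 0 < w / (80 * q) by rewrite divr_gt0 // mulr_gt0.
have lH0 := lt_le_trans wq0 lH.
have iw : w^-1 <= (q ^+ 5)^-1 by rewrite lef_pV2 ?posrE ?exprn_gt0.
have t3 : (L * (1 + L) + 2 * (1 + M) * M / (K ^ 6)%:R) / ln H.+1%:R <= q^-1.
  (* Here 43 is [42 + 1] from the two preceding bounds and 80 comes from [thresholdH]. *)
  apply: (@le_trans _ _ (43 * q ^+ 2 / (w / (80 * q)))).
    apply: ler_pM; [|by rewrite invr_ge0 ltW|by lra|by rewrite lef_pV2 ?posrE].
    apply: addr_ge0; first by apply: mulr_ge0; lra.
    by apply: divr_ge0 => //; apply: mulr_ge0 => //; apply: mulr_ge0; lra.
  have cq : 43 * 80 <= q.
    apply: le_trans q_huge; apply: (@le_trans _ _ (7 ^+ 2 * 7 ^+ 3)).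
      by apply: ler_pM => //; rewrite -natrX ler_nat.
    by rewrite -exprD ler_weXn2l // ler1n.
  have -> : 43 * q ^+ 2 / (w / (80 * q)) = (43 * 80) * q ^+ 3 * w^-1.
    by field; rewrite !lt0r_neq0.
  have c0 : 0 <= 43 * 80 :> R by rewrite mulr_ge0.
  move: (43 * 80) c0 cq => c c0 cq.
  apply: (@le_trans _ _ (c * q ^+ 3 * (q ^+ 5)^-1)).
    by apply: ler_wpM2l => //; apply: mulr_ge0 => //; apply: exprn_ge0; exact: ltW.
  have -> : c * q ^+ 3 * (q ^+ 5)^-1 = c / q * q^-1.
    by field; rewrite !lt0r_neq0.
  by rewrite ler_piMl ?invr_ge0 ?(ltW q0) // ler_pdivrMr // mul1r.
have t4 : 2 / K%:R <= q^-1.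
  rewrite ler_pdivrMr // mulrC ler_pdivlMr //.
  have : q * 4 <= w.
    apply: le_trans wq; rewrite exprS ler_pM2l //.
    by rewrite exprS; have := q_pow 3; have : q * 1 <= q * q ^+ 3; [rewrite ler_pM2l // q_pow|lra].
  have := Kge; lra.
rewrite mulrC; apply: ler_pM => //; last by lra.
apply: addr_ge0; first by apply: divr_ge0.
apply: divr_ge0; last exact: ltW.
apply: addr_ge0; first by apply: mulr_ge0; lra.
by apply: divr_ge0 => //; apply: mulr_ge0 => //; apply: mulr_ge0; lra.
Qed.

(** Of [y ^ 11], ten factors make up [d ^ (1 / 4)]. The eleventh absorbs [w ^ 3]: one [w] for the
    number of dyadic blocks, one for the bound on [sigma b / b], one for the logarithm in the claim.
    The constant is [960 = 3 * 160 * 2]. *)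
Lemma card_aliquot_multiples (d : nat) : (0 < d)%N ->
  x `^ (1 / (2 * ln q)) < d%:R ->
  #|` [fset n in (upto x `\` exceptional_set x)%fset | (d %| aliquot n)%N]%fset|%:R
    <= 960 * (x / (d%:R `^ (1 / 4) * w)).
Proof.
have ql := q_large; have wl := w_large.
move=> d0 dx; set s := [fset n in _ | _]%fset.
pose y : R := d%:R `^ (1 / 40).
have y0 : 0 < y by rewrite powR_gt0 // ltr0n.
have yX k : d%:R `^ (k%:R / 40) = y ^+ k :> R.
  rewrite -powR_mulrn ?(ltW y0) // -powRrM; congr (_ `^ _).
  by rewrite mul1r mulrC.
have dE : d%:R = y ^+ 40 by rewrite -yX divff // powRr1.
have d4 : d%:R `^ (1 / 4) = y ^+ 10 :> R.
  by rewrite -yX; congr (_ `^ _); field.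
have Hy : thresholdH x <= y.
  have -> : thresholdH x = (x `^ (1 / (2 * ln q))) `^ (1 / 40).
    by rewrite -powRrM /thresholdH; congr (_ `^ _); rewrite -/w -/q; field; rewrite lt0r_neq0.
  apply: ge0_ler_powR; rewrite ?nnegrE ?powR_ge0 //; exact: ltW.
have wy : w ^+ 3 <= y by apply: le_trans Hy.
have y1 : 1 <= y by apply: le_trans Hy.
have w1 : 1 <= w by lra.
have ww : w <= w ^+ 3 by rewrite exprS ler_peMr ?exprn_ege1 // ltW.
(* An integer above [1 + ln x], which bounds [sigma b / b] for [b <= x]. *)
pose h := (Num.truncn (1 + w)).+1.
have hw : h%:R <= 2 * w.
  rewrite /h -natr1; have : (Num.truncn (1 + w))%:R <= 1 + w by rewrite truncn_le; lra.
  lra.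
have sigw b : (0 < b <= Num.truncn x)%N -> (sigma b)%:R <= (1 + w) * b%:R.
  move=> /andP[b0 bN]; apply: (le_trans (sigma_le R b0)).
  rewrite ler_wpM2r // lerD2l ler_ln ?posrE ?ltr0n //.
  by apply: le_trans NleX; rewrite ler_nat.
have hh b : (0 < b <= Num.truncn x)%N -> (sigma b <= h * b)%N.
  move=> /sigw le; rewrite -(ler_nat R) natrM (le_trans le) // ler_wpM2r //.
  by have /andP[_ /ltW] := truncn_itv (ltac:(lra) : 0 <= 1 + w).
have sP : {in s, forall n, [/\ (Num.truncn (y ^+ 12) < n <= Num.truncn x)%N,
       (d %| aliquot n)%N, (gcdn n (sigma n) <= H)%N & sqfree_above K n]}.
  move=> n; rewrite /s !inE /= => /andP[/andP[+ nU] dn].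
  rewrite nU /= !negb_or negbK -leqNgt -ltnNge => /and3P[nK /asboolP sf gH].
  move: nU; rewrite mem_iota add1n ltnS => /andP[n0 nN].
  split => //; rewrite nN andbT.
  have KN : (K <= Num.truncn x)%N.
    by apply: leq_trans K6leN; rewrite -[leqLHS]expn1 leq_pexp2l.
  (* [n = 1] must be excluded since [aliquot 1 = 0] is divisible by every [d]; it is exceptional as
     [K <= Num.truncn x]. *)
  have n1 : (1 < n)%N.
    by rewrite ltn_neqAle n0 andbT; apply/eqP => e; move: nK; rewrite -e mul1n ltnNge KN.
  (* From [d <= sigma n <= (1 + w) * x] follows [y ^ 39 <= x]. Hence [y ^ 12 * K <= y ^ 13 <= x],
     and a non-exceptional [n], being above [x / K] up to rounding, exceeds [y ^ 12]. *)
  have dle : d%:R <= x * y.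
    apply: (@le_trans _ _ ((sigma n)%:R)).
      rewrite ler_nat -aliquotD //; apply: (leq_trans (dvdn_leq (aliquot_gt0 n1) dn)).
      exact: leq_addr.
    apply: (le_trans (sigw n _)); first by rewrite n0.
    rewrite mulrC; apply: ler_pM => //; [by lra| |].
      by apply: le_trans NleX; rewrite ler_nat.
    apply: le_trans wy; rewrite exprS.
    have h2 : 2 <= w ^+ 2.
      apply: (@le_trans _ _ w); first by lra.
      by rewrite expr2 ler_peMr // ltW.
    have : w * 2 <= w * w ^+ 2 by rewrite ler_pM2l.
    lra.
  have y39 : y ^+ 39 <= x by rewrite -(ler_pM2r y0) -exprSr -dE.
  have : (Num.truncn (y ^+ 12) * K <= Num.truncn x)%N.
    rewrite truncn_ge_nat ?(ltW x_pos) // natrM; apply: le_trans y39.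
    apply: (@le_trans _ _ (y ^+ 12 * y)).
      apply: ler_pM => //; first by rewrite truncn_le exprn_ge0 // ltW.
      by apply: (le_trans KleW); apply: le_trans wy.
    by rewrite -exprSr ler_weXn2l.
  by move=> le; have := leq_ltn_trans le nK; rewrite -/K ltn_mul2r => /andP[].
have Ky : K%:R ^+ 3 <= y by apply: le_trans wy; rewrite lerXn2r ?nnegrE ?(ltW w_pos).
have HyR : H%:R <= y by apply: le_trans Hy; rewrite truncn_le ltW.
have x1 : 1 <= x by have := x_large; lra.
apply: (le_trans (size_aliquot_multiples_real x1 y1 dE H_pos HyR K_pos Ky (ltn0Sn _) hh (fset_uniq s) sP)).
have T3 : (trunc_log 2 (Num.truncn x)).+1%:R <= 3 * w.
  rewrite -natr1; have := trunc_log2_le N_pos; have := lnN_le; lra.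
have Y0 : 0 < y ^+ 10 by rewrite exprn_gt0.
apply: (@le_trans _ _ (3 * w * (160 * (2 * w) * x / y ^+ 11))).
  apply: ler_pM; [exact: ler0n| |exact: T3|].
    apply: divr_ge0; last by apply: exprn_ge0; exact: ltW.
    by apply: mulr_ge0; [apply: mulr_ge0; exact: ler0n|exact: ltW].
  by rewrite ler_pM2r ?invr_gt0 ?exprn_gt0 // ler_pM2r // ler_pM2l.
rewrite d4 [y ^+ 11]exprS.
have -> : 3 * w * (160 * (2 * w) * x / (y * y ^+ 10)) =
  960 * (x / (y ^+ 10 * w)) * (w ^+ 3 / y).
  by move: (y ^+ 10) Y0 => Y Y0; field; rewrite !lt0r_neq0.
apply: ler_piMr; last by rewrite ler_pdivrMr // mul1r.
apply: mulr_ge0; first exact: ler0n.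
by apply: divr_ge0; [exact: ltW|apply: mulr_ge0; exact: ltW].
Qed.

End Estimates.
End LargeParameter.

(** * Letting [x] tend to infinity *)

Local Open Scope classical_set_scope.
Local Open Scope ring_scope.

Theorem theorem3p3 (R : realType) :
  exists (E : R -> {fset nat}) (C : R),
    [/\ 0 < C,
        #|` E x|%:R / x @[x --> +oo] --> (0 : R) &
        \forall x \near +oo,
          (E x `<=` upto x)%fset /\
          forall d : nat, (0 < d)%N ->
            x `^ (1 / (2 * logk 3 x)) < d%:R ->
            ((logk 2 x)%:E < Pminus R d)%E ->
            #|` [fset n in (upto x `\` E x)%fset | (d %| aliquot n)%N]%fset|%:R
              <= C * (x / (d%:R `^ (1 / 4) * logk 1 x))].
Proof.
have large (M : R) : \forall x \near +oo, M <= ln (ln x).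
  near=> x; have xM : expR (expR M) <= x by near: x; exact: nbhs_pinfty_ge.
  have x0 : 0 < x by apply: lt_le_trans xM; exact: expR_gt0.
  have : expR M <= ln x by rewrite -[expR M]expRK ler_ln ?posrE ?expR_gt0.
  move=> lM; have l0 : 0 < ln x by apply: lt_le_trans lM; exact: expR_gt0.
  by rewrite -[M]expRK ler_ln ?posrE ?expR_gt0.
exists (@exceptional_set R), 960; split; first by rewrite ltr0n.
- apply/cvgr0Pnorm_le => e e0; near=> x.
  have q1 : 7 ^+ 7 <= ln (ln x) by near: x; exact: large.
  have q2 : 2 / e <= ln (ln x) by near: x; exact: large.
  have x1 : 1 <= x by near: x; exact: nbhs_pinfty_ge.
  have x0 : 0 <= x by apply: le_trans x1.
  rewrite ger0_norm; last exact: divr_ge0.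
  apply: (le_trans (card_exceptional_set q1)).
  have q0 : 0 < ln (ln x) by apply: lt_le_trans q1; rewrite exprn_gt0 // ltr0n.
  by move: q2; rewrite (ler_pdivrMr _ _ e0) (ler_pdivrMr _ _ q0) mulrC.
- near=> x; split.
    by apply/fsubsetP => n; rewrite !inE => /andP[].
  move=> d d0 dx _; apply: card_aliquot_multiples => //.
  by near: x; exact: large.
Unshelve. all: by end_near.
Qed.
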